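(* Let $L/K$ be a finite Galois extension of fields with Galois group $(G,\circ)$, and let $G=(G,\cdot,\circ)$ be a skew brace which is the semidirect product of an ideal $A$ and a left ideal $B$. Let $H_G=L[G,\cdot]^{(G,\circ)}$, $H_A=L[A,\cdot]^{(G,\circ)}$ and $H_B=L[B,\cdot]^{(G,\circ)}$. Then the smash product $H_{A} \,\#_{K}\, H_{B}$ is defined, is a $K$-Hopf algebra, and is isomorphic to $H_{G}$ (as a $K$-Hopf algebra).
   Context: A (left) skew brace is a triple $(G,\cdot,\circ)$ in which $(G,\cdot)$ and $(G,\circ)$ are groups and $x \circ (y \cdot z) = (x \circ y) \cdot x^{-1} \cdot (x \circ z)$ for all $x,y,z \in G$, where $x^{-1}$ is the inverse for $\cdot$; $e$ is the common identity. Its $\gamma$-function is the homomorphism $\gamma : (G,\circ) \to \mathrm{Aut}(G,\cdot)$, $\gamma_x(y) = x^{-1}\cdot(x \circ y)$. A left ideal is a subset $A$ that is a subgroup with respect to either (hence both) operation(s) with $\gamma_x(A)=A$ for all $x\in G$; an ideal is a left ideal with $(A,\cdot)\trianglelefteq (G,\cdot)$ and $(A,\circ)\trianglelefteq(G,\circ)$. $G$ is the (internal) semidirect product of the ideal $A$ and left ideal $B$ if $A \cap B = \{e\}$, $A \cdot B = G$ and $A \circ B = G$. The group $(G,\circ)$ acts semilinearly on the group algebra $L[G,\cdot]$ by $x \star \sum_{y} c_{y} y = \sum_{y} x(c_{y}) \gamma_{x}(y)$; this preserves $L[A,\cdot]$ and $L[B,\cdot]$ and is compatible with the Hopf algebra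 structure maps, so the fixed rings $H_G$, $H_A$, $H_B$ are $K$-Hopf algebras, with $H_A$, $H_B$ Hopf subalgebras of $H_G$. $L[B,\cdot]$ acts on $L[A,\cdot]$ by $\left( \sum_{b \in B} z_{b} b \right) \bullet \left( \sum_{a \in A} w_{a} a \right) = \sum_{a,b} w_{a} z_{b}\, bab^{-1}$ (products with respect to $\cdot$). That the smash product $H_A \,\#_K\, H_B$ is defined means that $\bullet$ restricts to an action of $H_B$ on $H_A$ that respects the $K$-Hopf algebra structure maps of $H_A$ (in particular $H_A$ is a left $H_B$-module algebra); $H_A \,\#_K\, H_B$ is then $H_A\otimes_K H_B$ with multiplication $(w\# z)(w'\# z')=\sum w(z_{(1)}\bullet w')\# z_{(2)}z'$ and the tensor product coalgebra structure. *)

(* Defs.v *)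
From HB Require Import structures.
From mathcomp Require Import all_boot all_order all_algebra all_fingroup all_field.

Set Implicit Arguments.
Unset Strict Implicit.
Unset Printing Implicit Defensive.

Import GRing.Theory VectorInternalTheory.
Local Open Scope ring_scope.

(* Tensor products of finite dimensional vector spaces: V (x) W is modelled   *)
(* by matrices, v (x) w being the outer product of the coordinate vectors.    *)

Section Tensor.
Variable K : fieldType.
Implicit Types V W U : vectType K.

Definition tens V W : vectType K := 'M[K]_(dim V, dim W).

Definition tpure V W (v : V) (w : W) : tens V W := (v2r v)^T *m v2r w.

(* The linear map on V (x) W induced by f, meaningful for bilinear f (tliftE). *)
(* In Sweedler notation, tlift f (Delta h) is \sum f h_(1) h_(2).             *)
Definition tlift V W U (f : V -> W -> U) (t : tens V W) : U :=
  \sum_i \sum_j t i j *: f (r2v (delta_mx 0 i)) (r2v (delta_mx 0 j)).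

Definition bilin V W U (f : V -> W -> U) : Prop :=
  (forall v, linear (f v)) /\ (forall w, linear (f^~ w)).

Lemma tlift_is_linear V W U (f : V -> W -> U) : linear (tlift f).
Proof.
move=> a s t; rewrite /tlift scaler_sumr -big_split; apply: eq_bigr => i _.
rewrite scaler_sumr -big_split; apply: eq_bigr => j _.
by rewrite !mxE scalerDl scalerA.
Qed.

Lemma tliftE V W U (f : V -> W -> U) v w :
  bilin f -> tlift f (tpure v w) = f v w.
Proof.
case=> fl fr.
have expand (X : vectType K) (g : X -> U) (x : X) : linear g ->
    g x = \sum_i v2r x 0 i *: g (r2v (delta_mx 0 i)).
  move=> gl; pose gL : {linear X -> U} := HB.pack g (GRing.isLinear.Build _ _ _ _ g gl).
  rewrite -{1}[x]v2rK -[g]/(gL : _ -> _) {1}(row_sum_delta (v2r x)) !linear_sum.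
  by apply: eq_bigr => i _; rewrite !linearZ.
rewrite (expand _ (f^~ w) v (fr w)); apply: eq_bigr => i _.
rewrite (expand _ _ w (fl _)) scaler_sumr; apply: eq_bigr => j _.
by rewrite scalerA mxE big_ord1 !mxE.
Qed.

End Tensor.

Section HopfAlgebra.
Variable K : fieldType.

Record hopf_data := HopfData {
  hcar :> vectType K;
  hone : hcar;
  hmul : hcar -> hcar -> hcar;
  hcomul : hcar -> tens hcar hcar;
  hcounit : hcar -> K;
  hantip : hcar -> hcar }.

Record is_hopf_algebra (H : hopf_data) : Prop := IsHopfAlgebra {
  _ : bilin (@hmul H);
  _ : associative (@hmul H);
  _ : left_id (hone H) (@hmul H);
  _ : right_id (hone H) (@hmul H);
  _ : linear (@hcomul H);
  _ : scalar (@hcounit H);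
  (* coassociativity, with values in (H (x) H) (x) H *)
  _ : forall h : H,
      tlift (fun h1 h2 => tpure (hcomul h1) h2) (hcomul h) =
      tlift (fun h1 h2 =>
        tlift (fun h21 h22 => tpure (tpure h1 h21) h22) (hcomul h2)) (hcomul h);
  _ : forall h : H, tlift (fun h1 h2 => hcounit h1 *: h2) (hcomul h) = h;
  _ : forall h : H, tlift (fun h1 h2 => hcounit h2 *: h1) (hcomul h) = h;
  _ : hcomul (hone H) = tpure (hone H) (hone H);
  _ : forall g h : H, hcomul (hmul g h) =
      tlift (fun g1 g2 =>
        tlift (fun h1 h2 => tpure (hmul g1 h1) (hmul g2 h2)) (hcomul h))
        (hcomul g);
  _ : hcounit (hone H) = 1;
  _ : {morph (@hcounit H) : g h / hmul g h >-> g * h};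
  _ : linear (@hantip H);
  _ : forall h : H, tlift (fun h1 h2 => hmul (hantip h1) h2) (hcomul h) =
      hcounit h *: hone H;
  _ : forall h : H, tlift (fun h1 h2 => hmul h1 (hantip h2)) (hcomul h) =
      hcounit h *: hone H }.

Record hopf_iso (H H' : hopf_data) (f : H -> H') : Prop := HopfIso {
  _ : linear f;
  _ : bijective f;
  _ : f (hone H) = hone H';
  _ : {morph f : g h / hmul g h >-> hmul g h};
  _ : forall h, hcomul (f h) =
      tlift (fun h1 h2 => tpure (f h1) (f h2)) (hcomul h);
  _ : forall h, hcounit (f h) = hcounit h;
  _ : {morph f : h / hantip h >-> hantip h} }.

(* act is an action of the algebra H on M which respects the structure maps   *)
(* of the Hopf algebra M, H acting on M (x) M through the coproduct of H and  *)
(* on K through the counit of H.                                              *)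
Record hopf_module_action (H M : hopf_data) (act : H -> M -> M) : Prop :=
  HopfModuleAction {
  _ : bilin act;
  _ : forall w, act (hone H) w = w;
  _ : forall z z' w, act (hmul z z') w = act z (act z' w);
  _ : forall z, act z (hone M) = hcounit z *: hone M;
  _ : forall z w w', act z (hmul w w') =
      tlift (fun z1 z2 => hmul (act z1 w) (act z2 w')) (hcomul z);
  _ : forall z w, hcomul (act z w) =
      tlift (fun z1 z2 =>
        tlift (fun w1 w2 => tpure (act z1 w1) (act z2 w2)) (hcomul w))
        (hcomul z);
  _ : forall z w, hcounit (act z w) = hcounit z * hcounit w;
  _ : forall z w, hantip (act z w) = act z (hantip w) }.

Section Smash.
Variables (M H : hopf_data) (act : H -> M -> M).

Definition smash_mul (s t : tens M H) : tens M H :=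
  tlift (fun w z =>
    tlift (fun w' z' =>
      tlift (fun z1 z2 => tpure (hmul w (act z1 w')) (hmul z2 z'))
        (hcomul z)) t) s.

Definition smash_comul (s : tens M H) : tens (tens M H) (tens M H) :=
  tlift (fun w z =>
    tlift (fun w1 w2 =>
      tlift (fun z1 z2 => tpure (tpure w1 z1) (tpure w2 z2))
        (hcomul z)) (hcomul w)) s.

Definition smash_counit (s : tens M H) : K :=
  tlift (fun w z => hcounit w * hcounit z : K^o) s.

(* The bialgebra M # H, equipped with a candidate antipode. *)
Definition smash_product (S : tens M H -> tens M H) : hopf_data :=
  @HopfData (tens M H) (tpure (hone M) (hone H))
    smash_mul smash_comul smash_counit S.

End Smash.

End HopfAlgebra.

(* The group (G, .) of the skew brace is the finGroupType gT. *)
Record skew_brace (gT : finGroupType) := SkewBrace {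
  circ : gT -> gT -> gT;
  circ1 : gT;
  circV : gT -> gT;
  circA : associative circ;
  circ1x : left_id circ1 circ;
  circVx : left_inverse circ1 circV circ;
  circM : forall x y z : gT,
    circ x (y * z)%g = (circ x y * x^-1 * circ x z)%g }.

Section SkewBrace.
Variables (gT : finGroupType) (sb : skew_brace gT).
Implicit Types A B : {group gT}.

Definition gamma (x y : gT) : gT := (x^-1 * circ sb x y)%g.

Definition left_ideal A : Prop := forall x, [set gamma x a | a in A] = A.

Definition ideal A : Prop :=
  [/\ left_ideal A, (A <| [set: gT])%g &
      forall x, [set circ sb (circ sb x a) (circV sb x) | a in A] = A].

Definition internal_semidirect A B : Prop :=
  [/\ ideal A, left_ideal B, A :&: B = 1%g, (A * B)%g = [set: gT] &
      [set circ sb a b | a in A, b in B] = [set: gT]].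

Lemma gammaM x : {morph gamma x : y z / (y * z)%g}.
Proof. by move=> y z; rewrite /gamma circM !mulgA. Qed.

Lemma gamma1 x : gamma x 1 = 1%g.
Proof. by apply: (mulgI (gamma x 1)); rewrite -gammaM !mulg1. Qed.

End SkewBrace.

(* The group algebra L[G]; finfun itself carries the pointwise product. *)
Definition galg (K : fieldType) (L : fieldExtType K) (gT : finGroupType) :=
  {ffun gT -> L}.

Section GroupAlgebra.
Variables (K : fieldType) (L : fieldExtType K) (gT : finGroupType).
Local Notation LG := (galg L gT).

HB.instance Definition _ := Vector.on LG.

(* c x as an element of the free L-module L[T] on T *)
Definition gterm (T : finType) (c : L) (x : T) : {ffun T -> L} :=
  [ffun y => if y == x then c else 0].

Definition galg_one : LG := gterm 1 1%g.
Definition galg_mul (f g : LG) : LG :=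
  \sum_x \sum_y gterm (f x * g y) (x * y)%g.

Lemma sum_gterm (T I : finType) (c : I -> L) (h : I -> T) z :
  (\sum_i gterm (c i) (h i)) z = \sum_(i | h i == z) c i.
Proof.
rewrite sum_ffunE [RHS]big_mkcond; apply: eq_bigr => i _.
by rewrite ffunE eq_sym.
Qed.

Lemma galg_mulE f g z : galg_mul f g z = \sum_x f x * g (x^-1 * z)%g.
Proof.
rewrite sum_ffunE; apply: eq_bigr => x _; rewrite sum_gterm.
rewrite (big_pred1 (x^-1 * z)%g) // => y.
by apply/eqP/eqP => [<-|->]; rewrite ?mulKg ?mulKVg.
Qed.

Lemma galg_mulA : associative galg_mul.
Proof.
move=> f g h; apply/ffunP=> z; rewrite !galg_mulE.
under [RHS]eq_bigr do rewrite galg_mulE mulr_suml.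
rewrite exchange_big; apply: eq_bigr => x _.
rewrite galg_mulE mulr_sumr (reindex_inj (mulgI x^-1)%g).
by apply: eq_bigr => y _; rewrite mulrA invMg invgK mulgA mulgK.
Qed.

Lemma galg_mul1x : left_id galg_one galg_mul.
Proof.
move=> f; apply/ffunP=> z; rewrite galg_mulE (bigD1 1%g) //= big1 => [|x nx].
  by rewrite ffunE eqxx mul1r invg1 mul1g addr0.
by rewrite ffunE (negPf nx) mul0r.
Qed.

Lemma galg_mulx1 : right_id galg_one galg_mul.
Proof.
move=> f; apply/ffunP=> z; rewrite galg_mulE (bigD1 z) //= big1 => [|x nx].
  by rewrite ffunE mulVg eqxx mulr1 addr0.
by rewrite ffunE -eq_mulVg1 (negPf nx) mulr0.
Qed.

Lemma galg_mulDl : left_distributive galg_mul +%R.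
Proof.
move=> f g h; apply/ffunP=> z; rewrite [RHS]ffunE !galg_mulE -big_split.
by apply: eq_bigr => x _; rewrite ffunE mulrDl.
Qed.

Lemma galg_mulDr : right_distributive galg_mul +%R.
Proof.
move=> f g h; apply/ffunP=> z; rewrite [RHS]ffunE !galg_mulE -big_split.
by apply: eq_bigr => x _; rewrite ffunE mulrDr.
Qed.

Lemma galg_oner_neq0 : galg_one != 0.
Proof. by apply/eqP=> /ffunP/(_ 1%g)/eqP; rewrite !ffunE eqxx oner_eq0. Qed.

HB.instance Definition _ := GRing.Zmodule_isNzRing.Build LG
  galg_mulA galg_mul1x galg_mulx1 galg_mulDl galg_mulDr galg_oner_neq0.

Lemma galg_scalerAl (k : K) (f g : LG) : k *: (f * g) = k *: f * g.
Proof.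
apply/ffunP=> z; rewrite ffunE !galg_mulE scaler_sumr.
by apply: eq_bigr => x _; rewrite ffunE scalerAl.
Qed.

HB.instance Definition _ := GRing.Lmodule_isLalgebra.Build K LG galg_scalerAl.

Lemma galg_scalerAr (k : K) (f g : LG) : k *: (f * g) = f * (k *: g).
Proof.
apply/ffunP=> z; rewrite ffunE !galg_mulE scaler_sumr.
by apply: eq_bigr => x _; rewrite ffunE scalerAr.
Qed.

HB.instance Definition _ := GRing.Lalgebra_isAlgebra.Build K LG galg_scalerAr.
HB.instance Definition _ := Algebra_isFalgebra.Build K LG.

Lemma gtermM c d (x y : gT) :
  (gterm c x : LG) * (gterm d y : LG) = gterm (c * d) (x * y)%g.
Proof.
apply/ffunP=> z; rewrite galg_mulE (bigD1 x) //= big1 => [|u /negPf nux].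
  rewrite !ffunE eqxx addr0 -(inj_eq (mulgI x) (x^-1 * z)%g) mulKVg.
  by case: ifP; rewrite ?mulr0.
by rewrite !ffunE nux mul0r.
Qed.

(* The structure maps of the L-Hopf algebra L[G]; L[G] (x)_L L[G] is L[G x G]. *)
Definition galg_comul (f : LG) : {ffun gT * gT -> L} :=
  \sum_x gterm (f x) (x, x).
Definition galg_counit (f : LG) : L := \sum_x f x.
Definition galg_antip (f : LG) : LG := \sum_x gterm (f x) x^-1%g.

(* u (x)_L v in L[G x G] *)
Definition galg_pure (u v : LG) : {ffun gT * gT -> L} :=
  \sum_x \sum_y gterm (u x * v y) (x, y).

(* The L-span L[X] of X, i.e. the image of the projector L[G] -> L[X]. *)
Definition galg_proj (X : {set gT}) (f : LG) : LG :=
  \sum_(x in X) gterm (f x) x.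
Definition galg_on (X : {set gT}) : {vspace LG} :=
  fixedSpace (linfun (galg_proj X)).

Definition bullet (A B : {set gT}) (z w : LG) : LG :=
  \sum_(b in B) \sum_(a in A) gterm (w a * z b) (b * a * b^-1)%g.

End GroupAlgebra.

Section FixedRing.
Variables (K : fieldType) (L : splittingFieldType K) (gT : finGroupType).
Variables (sb : skew_brace gT) (sigma : gT -> gal_of {:L}).
Local Notation LG := (galg L gT).

(* sigma identifies (G, o) with Gal(L/K). It is stated pointwise because the  *)
(* product of gal_of composes automorphisms in the opposite order.            *)
Definition galois_identification : Prop :=
  [/\ injective sigma, [set sigma x | x in gT] = 'Gal({:L} / 1)%g &
      forall x y c, sigma (circ sb x y) c = sigma x (sigma y c)].

Definition star (x : gT) (f : LG) : LG :=
  \sum_y gterm (sigma x (f y)) (gamma sb x y).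

Definition fixed_space (X : {set gT}) : {vspace LG} :=
  (galg_on L X :&: \bigcap_x fixedSpace (linfun (star x)))%VS.

Lemma galg_proj_linear X : linear (@galg_proj K L gT X).
Proof.
move=> k f g; rewrite scaler_sumr -big_split; apply: eq_bigr => x _.
apply/ffunP=> z; rewrite !ffunE.
by case: eqP; rewrite ?ffunE // scaler0 addr0.
Qed.

Lemma star_linear x : linear (star x).
Proof.
move=> k f g; rewrite scaler_sumr -big_split; apply: eq_bigr => y _.
apply/ffunP=> z; rewrite !ffunE.
by case: eqP => _; rewrite ?scaler0 ?addr0 // linearP.
Qed.

Lemma linfunE_linear (U V : vectType K) (h : U -> V) :
  linear h -> linfun h =1 h.
Proof.
move=> hl u; pose hL : {linear U -> V} := HB.pack h (GRing.isLinear.Build _ _ _ _ h hl).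
by rewrite -[h]/(hL : _ -> _) lfunE.
Qed.

Lemma galg_onP (X : {set gT}) (f : LG) :
  reflect (forall y, y \notin X -> f y = 0) (f \in galg_on L X).
Proof.
apply: (iffP fixedSpaceP); rewrite (linfunE_linear (@galg_proj_linear X)).
  move=> <- y Xy; rewrite sum_ffunE big1 // => x Xx; rewrite ffunE.
  by case: eqP => // eyx; rewrite eyx Xx in Xy.
move=> f0; apply/ffunP=> y; rewrite sum_ffunE.
have [Xy | nXy] := boolP (y \in X).
  rewrite (bigD1 y) //= ffunE eqxx big1 ?addr0 // => x /andP[_ /negPf nxy].
  by rewrite ffunE eq_sym nxy.
rewrite f0 // big1 // => x Xx; rewrite ffunE; case: eqP => // eyx.
by rewrite eyx Xx in nXy.
Qed.

Lemma fixed_spaceP (X : {set gT}) (f : LG) :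
  reflect ((forall y, y \notin X -> f y = 0) /\ (forall x, star x f = f))
    (f \in fixed_space X).
Proof.
rewrite memv_cap; apply: (iffP andP) => [[/galg_onP fX] | [fX fG]].
  rewrite memvE => /subv_bigcapP fG; split=> // x.
  rewrite -{1}(linfunE_linear (@star_linear x)); apply/fixedSpaceP.
  by rewrite memvE fG.
split; first exact/galg_onP.
rewrite memvE; apply/subv_bigcapP => x _; rewrite -memvE.
by apply/fixedSpaceP; rewrite (linfunE_linear (@star_linear x)).
Qed.

HB.instance Definition _ x :=
  GRing.isLinear.Build K LG LG _ (star x) (@star_linear x).

Lemma star_gterm x c y : star x (gterm c y) = gterm (sigma x c) (gamma sb x y).
Proof.
apply/ffunP=> z; rewrite sum_ffunE (bigD1 y) //= big1 => [|u /negPf nuy].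
  by rewrite !ffunE eqxx addr0.
by rewrite !ffunE nuy rmorph0 if_same.
Qed.

Lemma starM x : {morph star x : f g / f * g}.
Proof.
move=> f g; rewrite [in LHS]/GRing.mul /= /galg_mul raddf_sum.
rewrite [in RHS]/star mulr_suml; apply: eq_bigr => y _.
rewrite raddf_sum mulr_sumr; apply: eq_bigr => z _.
by rewrite gtermM -gammaM -rmorphM; apply: star_gterm.
Qed.

Lemma star1 x : star x 1 = 1.
Proof. by rewrite [LHS]star_gterm rmorph1 gamma1. Qed.

Lemma fixed_space_is_aspace (X : {group gT}) : is_aspace (fixed_space X).
Proof.
rewrite /is_aspace has_algid1 /=; last first.
  apply/fixed_spaceP; split=> [y|x]; last exact: star1.
  by rewrite ffunE; case: eqP => // ->; rewrite group1.
apply/prodvP=> f g /fixed_spaceP[fX fG] /fixed_spaceP[gX gG].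
apply/fixed_spaceP; split=> [z nXz | x]; last by rewrite starM fG gG.
rewrite galg_mulE big1 // => x _.
have [Xx | /fX->] := boolP (x \in X); last by rewrite mul0r.
by rewrite gX ?mulr0 // groupMl // groupV.
Qed.

(* The ring L[X]^(G, o). *)
Definition fixed_ring (X : {group gT}) : {aspace LG} :=
  ASpace (fixed_space_is_aspace X).

(* The K-Hopf algebra L[X]^(G, o), for a left ideal X. Its structure maps are *)
(* the restrictions of those of L[G] (fixed_comulE, fixed_counitE and         *)
(* fixed_antipE below): the coproduct is pulled back along u (x)_K v |->      *)
(* u (x)_L v, which is injective on the tensor square of L[X]^(G, o)          *)
(* (fixed_pure_inj), and the counit along the inclusion of K into L.          *)
Definition fixed_hopf (X : {group gT}) : hopf_data K :=
  let H := subvs_of (fixed_ring X) in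
  @HopfData K H 1 *%R
    (fun h => (linfun (tlift (fun u v : H => galg_pure (vsval u) (vsval v))))^-1%VF
      (galg_comul (vsval h)))
    (fun h => ((linfun (fun k : K^o => (k : K) *: (1 : L)))^-1%VF (galg_counit (vsval h)) : K^o))
    (fun h => vsproj (fixed_ring X) (galg_antip (vsval h))).

Definition fixed_bullet (A B : {group gT}) (z : fixed_hopf B)
    (w : fixed_hopf A) : fixed_hopf A :=
  vsproj (fixed_ring A) (bullet A B (vsval z) (vsval w)).

Definition smash_defined (A B : {group gT}) : Prop :=
  (forall z w : LG, z \in fixed_ring B -> w \in fixed_ring A ->
     bullet A B z w \in fixed_ring A) /\
  hopf_module_action (@fixed_bullet A B).

End FixedRing.

Section SkewBraceTheory.
Variables (gT : finGroupType) (sb : skew_brace gT).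
Local Notation "x \o' y" := (circ sb x y) (at level 40).

Lemma circ1E : circ1 sb = 1%g.
Proof.
have:= circM sb (circ1 sb) 1%g 1%g; rewrite !circ1x !mul1g mulg1.
by move/esym/eqP; rewrite eq_invg1 => /eqP.
Qed.

Lemma circ_inj x : injective (circ sb x).
Proof.
apply: (@can_inj _ _ _ (circ sb (circV sb x))) => y.
by rewrite circA circVx circ1x.
Qed.

Lemma gamma_inj x : injective (gamma sb x).
Proof. by move=> y z /mulgI/circ_inj. Qed.

Lemma gamma_id y : gamma sb 1 y = y.
Proof. by rewrite /gamma -circ1E circ1x circ1E invg1 mul1g. Qed.

Lemma gamma_circ x y z : gamma sb (x \o' y) z = gamma sb x (gamma sb y z).
Proof.
apply: (mulgI (x \o' y)); rewrite mulKVg -circA.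
by rewrite -[in LHS](mulKVg y (y \o' z)) circM mulgA.
Qed.

Lemma gammaV x : {morph gamma sb x : y / (y^-1)%g}.
Proof.
by move=> y; apply: (mulgI (gamma sb x y)); rewrite -gammaM !mulgV gamma1.
Qed.

End SkewBraceTheory.

Section Descent.
Variables (K : fieldType) (L : splittingFieldType K) (gT : finGroupType).
Variables (sb : skew_brace gT) (sigma : gT -> gal_of {:L}).
Hypothesis galLK : galois 1 {:L}.
Hypothesis sigmaP : galois_identification sb sigma.
Local Notation LG := (galg L gT).

Let tr c := \sum_x sigma x c.

Lemma sigma1 c : sigma 1%g c = c.
Proof.
case: sigmaP => _ _ sM; apply: (fmorph_inj (sigma 1%g)).
by apply: etrans (esym (sM _ _ _)) _; rewrite -{1}(circ1E sb) circ1x.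
Qed.

Lemma sigma_fixed c : (forall x, sigma x c = c) -> exists k : K, c = k *: 1.
Proof.
case: sigmaP => _ simg _ cfix; apply/vlineP.
have /galois_fixedField <- := galLK.
apply/fixedFieldP; rewrite ?memvf // => s; rewrite -simg.
by case/imsetP=> x _ ->.
Qed.

Lemma sigma_tr x c : sigma x (tr c) = tr c.
Proof.
case: sigmaP => _ _ sM; rewrite rmorph_sum /tr.
by rewrite [RHS](reindex_inj (@circ_inj _ sb x)); apply: eq_bigr => y _.
Qed.

Lemma tr_scalar c : exists k : K, tr c = k *: 1.
Proof. by apply: sigma_fixed => x; apply: sigma_tr. Qed.

Lemma dual_family : exists n (v w : 'I_n -> L),
  forall x, \sum_i v i * sigma x (w i) = (x == 1%g)%:R.
Proof.
case: sigmaP => sI _ _; case: (gal_matrix [set: gal_of {:L}]) => w _ [uM _ _].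
set M := \matrix_(i, j) _ in uM.
pose r s := enum_rank_in (in_setT (sigma 1%g)) s.
have rK s : enum_val (r s) = s by rewrite enum_rankK_in ?in_setT.
exists _, (fun j => invmx M j (r (sigma 1%g))), (fun j => tnth w j) => x.
transitivity ((M *m invmx M) (r (sigma x)) (r (sigma 1%g))).
  by rewrite mxE; apply: eq_bigr => j _; rewrite [M _ _]mxE rK mulrC.
by rewrite mulmxV // mxE -(inj_eq enum_val_inj) !rK (inj_eq sI).
Qed.

Lemma tr_nondeg c : (forall d, tr (d * c) = 0) -> c = 0.
Proof.
move=> trc; have [n [v [w vw]]] := dual_family.
transitivity (\sum_i v i * tr (w i * c)); last first.
  by rewrite big1 // => i _; rewrite trc mulr0.
under eq_bigr do rewrite /tr mulr_sumr; rewrite exchange_big /=.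
have E x : \sum_i v i * sigma x (w i * c) = (x == 1%g)%:R * sigma x c.
  by under eq_bigr do rewrite rmorphM mulrA; rewrite -mulr_suml vw.
under eq_bigr do rewrite E.
rewrite (bigD1 1%g) //= eqxx mul1r sigma1 big1 ?addr0 // => x /negPf->.
by rewrite mul0r.
Qed.

Lemma tr_one : exists t, tr t = 1.
Proof.
have [n [v [w vw]]] := dual_family.
have [j nzj | tr0] := pickP (fun j => tr (w j) != 0).
  have [k Dk] := tr_scalar (w j); exists (k^-1 *: w j).
  have nzk : k != 0 by apply: contraNneq nzj => k0; rewrite Dk k0 scale0r.
  rewrite /tr; under eq_bigr do rewrite linearZ; rewrite -scaler_sumr -/(tr _).
  by rewrite Dk scalerA mulVf ?scale1r.
have/eqP[] := oner_neq0 L; transitivity (\sum_i v i * tr (w i)); last first.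
  by rewrite big1 // => i _; have /eqP-> := negbFE (tr0 i); rewrite mulr0.
under eq_bigr do rewrite /tr mulr_sumr; rewrite exchange_big /=.
under eq_bigr do rewrite vw.
by rewrite (bigD1 1%g) //= eqxx big1 ?addr0 // => x /negPf->.
Qed.

Lemma star_gammaE x (f : LG) y : star sb sigma x f (gamma sb x y) = sigma x (f y).
Proof.
by rewrite sum_gterm (big_pred1 y) // => z; rewrite (inj_eq (@gamma_inj _ sb x)).
Qed.

Lemma fixed_gammaE (X : {set gT}) (f : LG) x y :
  f \in fixed_space sb sigma X -> f (gamma sb x y) = sigma x (f y).
Proof. by case/fixed_spaceP=> _ /(_ x) {1}<-; rewrite star_gammaE. Qed.

Lemma fixed_spaceI (X : {set gT}) (f : LG) : 
    (forall y, y \notin X -> f y = 0) ->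
    (forall x y, f (gamma sb x y) = sigma x (f y)) ->
  f \in fixed_space sb sigma X.
Proof.
move=> fX fG; apply/fixed_spaceP; split=> // x; apply/ffunP=> z.
have [g _ gK] := injF_bij (@gamma_inj _ sb x).
by rewrite -(gK z) star_gammaE fG.
Qed.

Variable X : {group gT}.
Hypothesis leftX : left_ideal sb X.
Local Notation H := (subvs_of (fixed_ring sb sigma X)).
Local Notation iota := (tlift (fun u v : H => galg_pure (vsval u) (vsval v))).

Lemma gamma_mem x y : (gamma sb x y \in X) = (y \in X).
Proof. by rewrite -{1}(leftX x) mem_imset //; apply: gamma_inj. Qed.

Lemma galg_pureE (u v : LG) x y : galg_pure u v (x, y) = u x * v y.
Proof.
rewrite /galg_pure pair_big /= sum_gterm (big_pred1 (x, y)) // => -[a b].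
Qed.

Lemma galg_comulE (f : LG) x y : galg_comul f (x, y) = f x *+ (x == y).
Proof.
rewrite sum_gterm; have [<- | nxy] := eqVneq.
  by rewrite (big_pred1 x) // => z; rewrite xpair_eqE andbb.
rewrite big1 // => z; rewrite xpair_eqE => /andP[/eqP-> /eqP zy].
by rewrite zy eqxx in nxy.
Qed.

Lemma pure_bilin : bilin (fun u v : H => galg_pure (vsval u) (vsval v)).
Proof.
split=> u k v w; apply/ffunP=> -[x y]; rewrite 2!ffunE !galg_pureE.
  by rewrite linearP !ffunE mulrDr scalerAr.
by rewrite linearP !ffunE mulrDl scalerAl.
Qed.

Lemma span_fixed : exists n (v : 'I_n -> L) (u : gT -> 'I_n -> H),
  forall y z, y \in X -> \sum_i v i * vsval (u y i) z = (z == y)%:R.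
Proof.
have [n [v [w vw]]] := dual_family.
pose U y i : LG := \sum_x gterm (sigma x (w i)) (gamma sb x y).
have HU y i : y \in X -> U y i \in fixed_ring sb sigma X.
  move=> Xy; case: sigmaP => _ _ sM; apply: fixed_spaceI => [z nXz | x z].
    rewrite sum_gterm big1 // => x /eqP zx; case/negP: nXz.
    by rewrite -zx gamma_mem.
  rewrite !sum_gterm rmorph_sum (reindex_inj (@circ_inj _ sb x)) /=.
  apply: eq_big => [t | t _]; last exact: sM.
  by rewrite gamma_circ (inj_eq (@gamma_inj _ sb x)).
exists n, v, (fun y i => vsproj (fixed_ring sb sigma X) (U y i)) => y z Xy.
under eq_bigr do rewrite vsprojK ?HU // sum_gterm mulr_sumr big_mkcond /=.
rewrite exchange_big /=; pose F x : L := (if gamma sb x y == z then (x == 1%g)%:R else 0).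
transitivity (\sum_x F x).
  by apply: eq_bigr => x _; rewrite /F; case: ifP => _; rewrite ?vw // big1.
rewrite (bigD1 1%g) //= big1 /F => [|x /negPf->]; last by rewrite if_same.
by rewrite gamma_id eq_sym eqxx addr0; case: ifP.
Qed.

Lemma comul_decomp (h : H) : exists (I : finType) (d : I -> L) (p q : I -> H),
  forall a b, galg_comul (vsval h) (a, b) =
    \sum_i d i * (vsval (p i) a * vsval (q i) b).
Proof.
have [n [v [u vu]]] := span_fixed.
exists (gT * ('I_n * 'I_n))%type,
  (fun t => vsval h t.1 * (v t.2.1 * v t.2.2)),
  (fun t => u t.1 t.2.1), (fun t => u t.1 t.2.2) => a b.
pose F y ij := vsval h y * (v ij.1 * v ij.2) *
  (vsval (u y ij.1) a * vsval (u y ij.2) b).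
rewrite -(pair_bigA _ F) /F /=.
transitivity (\sum_y vsval h y * ((a == y)%:R * (b == y)%:R)).
  rewrite galg_comulE (bigD1 a) //= big1 => [|y /negPf nya].
    by rewrite eqxx mul1r addr0 eq_sym mulr_natr.
  by rewrite eq_sym nya mul0r mulr0.
apply: eq_bigr => y _; have [Xy | nXy] := boolP (y \in X); last first.
  have /fixed_spaceP[/(_ y nXy) h0 _] := valP h.
  by rewrite h0 mul0r big1 // => ij _; rewrite !mul0r.
rewrite -!(vu _ _ Xy) mulr_suml mulr_sumr; apply/esym.
rewrite -(pair_bigA _ (fun i j => vsval h y * (v i * v j) *
  (vsval (u y i) a * vsval (u y j) b))) /=.
apply: eq_bigr => i _; rewrite mulr_sumr mulr_sumr; apply: eq_bigr => j _.
by rewrite -!mulrA; congr (_ * (_ * _)); rewrite mulrCA.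
Qed.

Lemma fixed_pure_comul (h : H) : exists t : tens H H, iota t = galg_comul (vsval h).
Proof.
have [I [d [p [q Dh]]]] := comul_decomp h; have [t trt] := tr_one.
have trk c := tr_scalar c.
have {trk}[k Dk] := fin_all_exists (fun i => trk (t * d i)).
pose iotaL : {linear tens H H -> {ffun gT * gT -> L}} :=
  HB.pack iota (GRing.isLinear.Build K (tens H H) {ffun gT * gT -> L} _ iota
    (@tlift_is_linear K H H {ffun gT * gT -> L} _)).
exists (\sum_i k i *: tpure (p i) (q i)); apply/ffunP=> -[a b].
rewrite -[iota]/(iotaL : _ -> _) linear_sum sum_ffunE.
transitivity (\sum_i tr (t * d i) * (vsval (p i) a * vsval (q i) b)).
  apply: eq_bigr => i _; rewrite linearZ ffunE /= tliftE; last exact: pure_bilin.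
  by rewrite galg_pureE Dk -scalerAl mul1r.
under eq_bigr do rewrite /tr mulr_suml.
rewrite exchange_big -[RHS]mul1r -trt mulr_suml; apply: eq_bigr => x _.
have [g _ gK] := injF_bij (@gamma_inj _ sb x).
rewrite -(gK a) -(gK b); set a' := g a; set b' := g b.
have -> : galg_comul (vsval h) (gamma sb x a', gamma sb x b') =
    sigma x (galg_comul (vsval h) (a', b')).
  rewrite !galg_comulE (inj_eq (@gamma_inj _ sb x)) rmorphMn /=.
  by rewrite (fixed_gammaE _ _ (valP h)).
rewrite Dh rmorph_sum mulr_sumr; apply: eq_bigr => i _.
rewrite !rmorphM !mulrA (fixed_gammaE _ _ (valP (p i))).
by rewrite (fixed_gammaE _ _ (valP (q i))).
Qed.

Lemma fixed_indep n (c : 'I_n -> L) (b : 'I_n -> H) :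
    (forall k : 'I_n -> K, \sum_i k i *: b i = 0 -> forall i, k i = 0) ->
    (forall x, \sum_i c i * vsval (b i) x = 0) ->
  forall i, c i = 0.
Proof.
move=> indb cb0 i; apply: tr_nondeg => d.
have {}[k Dk] := fin_all_exists (fun j => tr_scalar (d * c j)).
suffices k0 : \sum_j k j *: b j = 0 by rewrite Dk (indb k k0) scale0r.
apply: val_inj; rewrite /= linear_sum /=; apply/ffunP=> a; rewrite sum_ffunE ffunE.
transitivity (\sum_x \sum_j sigma x (d * c j) * vsval (b j) a).
  rewrite exchange_big; apply: eq_bigr => j _.
  by rewrite ffunE -mulr_suml -/(tr _) Dk -scalerAl mul1r.
rewrite big1 // => x _; have [g _ gK] := injF_bij (@gamma_inj _ sb x).
transitivity (sigma x (d * \sum_j c j * vsval (b j) (g a))); last first.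
  by rewrite cb0 mulr0 rmorph0.
rewrite mulr_sumr rmorph_sum; apply: eq_bigr => j _.
by rewrite -{1}(gK a) (fixed_gammaE _ _ (valP (b j))) mulrA [in RHS]rmorphM.
Qed.

Lemma fixed_pure_inj : injective iota.
Proof.
pose iotaL : {linear tens H H -> {ffun gT * gT -> L}} :=
  HB.pack iota (GRing.isLinear.Build K (tens H H) {ffun gT * gT -> L} _ iota
    (@tlift_is_linear K H H {ffun gT * gT -> L} _)).
pose b (i : 'I_(dim H)) : H := r2v (delta_mx 0 i).
have indb (k : 'I_(dim H) -> K) : \sum_i k i *: b i = 0 -> forall i, k i = 0.
  move=> kb0 i; have /rowP/(_ i) : \row_i k i = 0 :> 'rV_(dim H).
    apply: (can_inj r2vK); rewrite linear0 -kb0 (row_sum_delta (\row_i0 k i0)).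
    by rewrite linear_sum; apply: eq_bigr => j _; rewrite linearZ mxE.
  by rewrite !mxE.
suffices iota0 t : iotaL t = 0 -> t = 0.
  move=> s t st; apply/eqP; rewrite -subr_eq0; apply/eqP/iota0.
  by rewrite linearB /= st subrr.
move=> t0; apply/matrixP=> i j.
have E x y : \sum_i (\sum_j t i j *: vsval (b j) y) * vsval (b i) x = 0.
  have /ffunP/(_ (x, y)) := t0; rewrite /= /tlift sum_ffunE [RHS]ffunE => xy0.
  apply: etrans xy0.
  apply: eq_bigr => i1 _; rewrite sum_ffunE mulr_suml; apply: eq_bigr => j1 _.
  by rewrite ffunE galg_pureE -scalerAl mulrC.
suffices /(_ j) : forall j, (t i j)%:A = 0 :> L.
  by move/eqP; rewrite scaler_eq0 oner_eq0 orbF mxE => /eqP.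
apply: (fixed_indep indb) => y.
rewrite -[RHS](fixed_indep indb (E^~ y) i).
by apply: eq_bigr => j1 _; rewrite -scalerAl mul1r.
Qed.

Lemma fixed_comulE (h : H) :
  iota (hcomul (h : fixed_hopf sb sigma X)) = galg_comul (vsval h).
Proof.
have [t Dt] := fixed_pure_comul h; rewrite /=.
have iE := @linfunE_linear K (tens H H) {ffun gT * gT -> L} iota (@tlift_is_linear K H H {ffun gT * gT -> L} _).
by rewrite -iE limg_lfunVK // -Dt -iE memv_img ?memvf.
Qed.

Lemma fixed_counitE (h : H) :
  hcounit (h : fixed_hopf sb sigma X) *: 1 = galg_counit (vsval h).
Proof.
have [x|k Dk] := @sigma_fixed (galg_counit (vsval h)).
  rewrite [RHS](reindex_inj (@gamma_inj _ sb x)) rmorph_sum.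
  by apply: eq_bigr => y _; rewrite (fixed_gammaE _ _ (valP h)).
have sl : linear (fun k : K^o => (k : K) *: (1 : L)).
  by move=> a u v; rewrite scalerDl scalerA.
rewrite /=; set f := linfun _.
have fE : f =1 _ := linfunE_linear sl.
by rewrite -[LHS]fE limg_lfunVK // Dk -fE memv_img ?memvf.
Qed.

Lemma fixed_antipE (h : H) :
  vsval (hantip (h : fixed_hopf sb sigma X)) = galg_antip (vsval h).
Proof.
have aE y : galg_antip (vsval h) y = vsval h y^-1%g.
  by rewrite sum_gterm (big_pred1 y^-1%g) // => x; rewrite /= (can2_eq invgK invgK).
rewrite /= vsprojK //; apply: fixed_spaceI => [y nXy | x y].
  have /fixed_spaceP[hX _] := valP h.
  by rewrite aE hX // groupV.
by rewrite !aE -gammaV (fixed_gammaE _ _ (valP h)).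
Qed.

End Descent.

(* Main.v *)
(* L (x)_K H_X is L[X], so the identities to be proved between K-linear maps   *)
(* can be checked after extending scalars to L. There every structure map,     *)
(* including the action and the multiplication w # z |-> w z from H_A # H_B    *)
(* to H_G, is the L-linear extension of a map of sets, and the identities      *)
(* become those of the group G = A ><| B, with B acting on A by conjugation.   *)
(* The map H_A # H_B -> H_G is injective since A :&: B = 1, and bijective      *)
(* since dim H_X = #|X|.                                                       *)
From HB Require Import structures.
Require Import Defs.
From mathcomp Require Import all_boot all_order all_algebra all_fingroup all_field.

Set Implicit Arguments.
Unset Strict Implicit.
Unset Printing Implicit Defensive.

Import GRing.Theory VectorInternalTheory.
Local Open Scope ring_scope.

(** Each Hopf algebra in play embeds into some L[T], where T is a finite set with a unit, a product
    and an inverse map, in such a way that its structure maps become the L-linear extensions of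
    product, diagonal, map to a point and inverse. [realization] records this. Its central clause
    [Linjective] says that the embedding stays injective after extending scalars to L; unlike mere
    K-linear injectivity, this passes to tensor products ([Linj_tens]). Hence an identity with
    values in H, in its tensor square or in its tensor cube can be tested in L[T], L[T x T] or
    L[T x T x T], where it is an identity between maps of finite sets. Thus group axioms on T give
    the Hopf axioms ([realized_hopf_algebra]), an action by automorphisms gives a Hopf module action
    ([realized_module_action]), and a homomorphism gives compatibility with all structure maps
    ([realized_hopf_iso]).

    Galois descent provides the realizations of the fixed rings ([fixed_val_Linj],
    [realized_fixed]). The action [bullet] is realized by conjugation, so the smash product is
    realized by the semidirect product law (a, b)(a', b') = (a b a' b^-1, b b') ([realized_smash]).
    The homomorphism (a, b) |-> a b realizes the map w # z |-> w z into the fixed ring of L[G]. This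
    map is injective because A and B meet trivially, and a dimension count based on [fixed_dim] and
    |G| = |A| |B| makes it bijective. *)

(** * Linear maps and Sweedler sums *)

Section Linear.
Variable K : fieldType.

Lemma linear_sumE (U V : lmodType K) (g : U -> V) (I : finType) (k : I -> K) (h : I -> U) :
  linear g -> g (\sum_i k i *: h i) = \sum_i k i *: g (h i).
Proof.
move=> gl; pose gL : {linear U -> V} := HB.pack g (GRing.isLinear.Build _ _ _ _ g gl).
rewrite -[g]/(gL : _ -> _) linear_sum.
by apply: eq_bigr => i _; rewrite linearZ.
Qed.

Lemma linear_scaleE (U V : lmodType K) (g : U -> V) k u :
  linear g -> g (k *: u) = k *: g u.
Proof.
move=> gl; pose gL : {linear U -> V} := HB.pack g (GRing.isLinear.Build _ _ _ _ g gl).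
by rewrite -[g]/(gL : _ -> _) linearZ.
Qed.

Lemma linear_tlift (V W : vectType K) (U U' : vectType K) (g : U -> U') (f : V -> W -> U) t :
  linear g -> g (tlift f t) = tlift (fun v w => g (f v w)) t.
Proof.
move=> gl; pose gL : {linear U -> U'} := HB.pack g (GRing.isLinear.Build _ _ _ _ g gl).
rewrite -[g]/(gL : _ -> _) linear_sum; apply: eq_bigr => i _.
by rewrite linear_sum; apply: eq_bigr => j _; rewrite linearZ.
Qed.

Lemma eq_tlift (V W U : vectType K) (f g : V -> W -> U) t :
  (forall v w, f v w = g v w) -> tlift f t = tlift g t.
Proof.
by move=> fg; apply: eq_bigr => i _; apply: eq_bigr => j _; rewrite fg.
Qed.

Lemma coord_sum (V : vectType K) (v : V) :
  v = \sum_i v2r v 0 i *: r2v (delta_mx 0 i).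
Proof.
rewrite -{1}[v]v2rK {1}(row_sum_delta (v2r v)) linear_sum.
by apply: eq_bigr => i _; rewrite linearZ.
Qed.

Lemma linear_inj_bij (V W : vectType K) (f : V -> W) :
  linear f -> injective f -> (dim W <= dim V)%N -> bijective f.
Proof.
move=> fl fI leWV; pose fL : {linear V -> W} := HB.pack f (GRing.isLinear.Build _ _ _ _ f fl).
pose F := linfun fL; have FE v : F v = f v by rewrite lfunE.
have kF : lker F == 0%VS by apply/lker0P=> u v; rewrite !FE => /fI.
have imF : limg F = fullv.
  apply/eqP; rewrite eqEdim subvf /= !dimvf limg_dim_eq ?dimvf //.
  by rewrite (eqP kF) capv0.
exists (F^-1)%VF => [v | w]; first by rewrite -FE lker0_lfunK.
by rewrite -FE limg_lfunVK // imF memvf.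
Qed.

End Linear.

(** * Calculus in the free modules L[T] on finite sets *)

Section Push.
Variables (K : fieldType) (L : fieldExtType K).
Implicit Types T : finType.

(** The L-linear extension of [g]; every structure map of a group algebra is of this form. *)
Definition push T T' (g : T -> T') (u : {ffun T -> L}) : {ffun T' -> L} :=
  \sum_x gterm (u x) (g x).

(** The tensor u (x)_L v, under the identification of L[T] (x)_L L[T'] with L[T x T']. *)
Definition box T T' (u : {ffun T -> L}) (v : {ffun T' -> L}) : {ffun T * T' -> L} :=
  [ffun p => u p.1 * v p.2].

Lemma ffun_sum_gterm T (u : {ffun T -> L}) : \sum_x gterm (u x) x = u.
Proof. by apply/ffunP=> y; rewrite sum_gterm big_pred1_eq. Qed.

Lemma pushE T T' (g : T -> T') u y : push g u y = \sum_(x | g x == y) u x.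
Proof. exact: sum_gterm. Qed.

Lemma push_linear T T' (g : T -> T') : linear (push g).
Proof.
move=> k u v; apply/ffunP=> y; rewrite 2!ffunE !pushE scaler_sumr -big_split.
by apply: eq_bigr => x _; rewrite !ffunE.
Qed.

HB.instance Definition _ T T' (g : T -> T') :=
  GRing.isLinear.Build K {ffun T -> L} {ffun T' -> L} _ (push g) (push_linear g).

Lemma push_gterm T T' (g : T -> T') c x : push g (gterm c x) = gterm c (g x).
Proof.
apply/ffunP=> y; rewrite sum_ffunE (bigD1 x) //= big1 => [|z /negPf nzx].
  by rewrite !ffunE eqxx addr0.
by rewrite !ffunE nzx if_same.
Qed.

Lemma push_comp T1 T2 T3 (h : T2 -> T3) (g : T1 -> T2) u :
  push h (push g u) = push (h \o g) u.
Proof.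
by rewrite [push g u]/push linear_sum; apply: eq_bigr => x _; rewrite /= push_gterm.
Qed.

Lemma eq_push T T' (g h : T -> T') u : g =1 h -> push g u = push h u.
Proof. by move=> gh; apply: eq_bigr => x _; rewrite gh. Qed.

Lemma push_id T (u : {ffun T -> L}) : push id u = u.
Proof. exact: ffun_sum_gterm. Qed.

Lemma box_linearr T T' (u : {ffun T -> L}) : linear (@box T T' u).
Proof.
by move=> k v w; apply/ffunP=> p; rewrite !ffunE mulrDr scalerAr.
Qed.

Lemma box_linearl T T' (v : {ffun T' -> L}) : linear ((@box T T')^~ v).
Proof.
by move=> k u w; apply/ffunP=> p; rewrite !ffunE mulrDl scalerAl.
Qed.

Lemma box_gterm T T' c d (x : T) (y : T') :
  box (gterm c x) (gterm d y) = gterm (c * d) (x, y).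
Proof.
apply/ffunP=> -[x' y']; rewrite !ffunE xpair_eqE /=.
by do 2!case: ifP => //=; rewrite ?mul0r ?mulr0.
Qed.

Lemma push_boxE T1 T2 T (g : T1 * T2 -> T) (u : {ffun T1 -> L}) v :
  push g (box u v) = \sum_x \sum_y gterm (u x * v y) (g (x, y)).
Proof.
rewrite pair_bigA /=; apply: eq_bigr => -[x y] _ /=.
by rewrite ffunE.
Qed.

Lemma push_box T1 T2 T1' T2' (g : T1 -> T1') (h : T2 -> T2')
    (u : {ffun T1 -> L}) v :
  box (push g u) (push h v) = push (fun p => (g p.1, h p.2)) (box u v).
Proof.
apply/ffunP=> -[x y]; rewrite ffunE /= !pushE big_distrlr /= pair_big /=.
apply: eq_big => [[a b]|[a b] _] /=; first by rewrite xpair_eqE.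
by rewrite ffunE.
Qed.

Lemma push_boxl T1 T2 T1' (g : T1 -> T1') (u : {ffun T1 -> L}) (v : {ffun T2 -> L}) :
  box (push g u) v = push (fun p => (g p.1, p.2)) (box u v).
Proof. by rewrite -{1}[v]push_id push_box. Qed.

Lemma push_boxr T1 T2 T2' (h : T2 -> T2') (u : {ffun T1 -> L}) (v : {ffun T2 -> L}) :
  box u (push h v) = push (fun p => (p.1, h p.2)) (box u v).
Proof. by rewrite -{1}[u]push_id push_box. Qed.

Lemma box_assoc T1 T2 T3 (u : {ffun T1 -> L}) (v : {ffun T2 -> L}) (w : {ffun T3 -> L}) :
  box u (box v w) = push (fun p => (p.1.1, (p.1.2, p.2))) (box (box u v) w).
Proof.
apply/ffunP=> -[x [y z]]; rewrite pushE (big_pred1 (x, y, z)).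
  by rewrite !ffunE mulrA.
by case=> [[a b] c]; rewrite /= -!pair_eqE /pair_eq /= andbA.
Qed.

Lemma box_assocV T1 T2 T3 (u : {ffun T1 -> L}) (v : {ffun T2 -> L}) (w : {ffun T3 -> L}) :
  box (box u v) w = push (fun p => ((p.1, p.2.1), p.2.2)) (box u (box v w)).
Proof. by rewrite box_assoc push_comp -[LHS]push_id; apply: eq_push => -[[]]. Qed.

Lemma box_comm T1 T2 (u : {ffun T1 -> L}) (v : {ffun T2 -> L}) :
  box u v = push (fun p => (p.2, p.1)) (box v u).
Proof.
apply/ffunP=> -[x y]; rewrite pushE (big_pred1 (y, x)); first by rewrite !ffunE mulrC.
by case=> [a b]; rewrite /= !xpair_eqE andbC.
Qed.

Lemma box_gterm1l T1 T2 (x : T1) (v : {ffun T2 -> L}) :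
  box (gterm 1 x) v = push (pair x) v.
Proof.
apply/ffunP=> -[a b]; rewrite !ffunE pushE /=.
have [-> | nax] := eqVneq a x.
  by rewrite mul1r (big_pred1 b) // => y; rewrite xpair_eqE eqxx.
by rewrite mul0r big1 // => y; rewrite xpair_eqE eq_sym (negPf nax).
Qed.

Lemma box_gterm1r T1 T2 (u : {ffun T1 -> L}) (y : T2) :
  box u (gterm 1 y) = push (pair^~ y) u.
Proof. by rewrite box_comm box_gterm1l push_comp. Qed.

(** The middle interchange, needed wherever tensors are multiplied or acted on factor by factor. *)
Lemma box_swap T1 T2 T3 T4 (u1 : {ffun T1 -> L}) (u2 : {ffun T2 -> L})
    (v1 : {ffun T3 -> L}) (v2 : {ffun T4 -> L}) :
  box (box u1 v1) (box u2 v2) =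
  push (fun p => ((p.1.1, p.2.1), (p.1.2, p.2.2))) (box (box u1 u2) (box v1 v2)).
Proof.
apply/ffunP=> -[[x1 y1] [x2 y2]]; rewrite pushE (big_pred1 ((x1, x2), (y1, y2))).
  by rewrite !ffunE mulrACA.
by case=> [[a b] [c d]]; rewrite /= -!pair_eqE /pair_eq /= -!pair_eqE /pair_eq /= andbACA.
Qed.

Definition total T (u : {ffun T -> L}) : L := \sum_x u x.

Lemma push_total T T' (g : T -> T') u : total (push g u) = total u.
Proof.
rewrite /total; under eq_bigr do rewrite pushE.
by rewrite [RHS](partition_big g xpredT).
Qed.

Lemma total_box T T' (u : {ffun T -> L}) (v : {ffun T' -> L}) :
  total (box u v) = total u * total v.
Proof.
rewrite /total big_distrlr pair_bigA /=.
by apply: eq_bigr => p _; rewrite ffunE.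
Qed.

Lemma total_gterm T c (x : T) : total (gterm c x) = c.
Proof.
rewrite /total (bigD1 x) //= big1 => [|y /negPf nyx]; rewrite ffunE ?eqxx ?addr0 //.
by rewrite nyx.
Qed.

(** Serves the counit axiom: [total] is the counit of L[T], and on realized elements its value is a
    scalar from K. *)
Lemma push_snd_box T T' (k : K) (u : {ffun T -> L}) (v : {ffun T' -> L}) :
  total u = k%:A -> push snd (box u v) = k *: v.
Proof.
move=> uk; apply/ffunP=> y; rewrite ffunE pushE -[RHS]mulr_algl -uk mulr_suml.
rewrite (reindex_onto (pair^~ y) fst) /= => [|[a b] /eqP /= -> //].
by apply: eq_big => [x|x _]; rewrite ?ffunE // !eqxx.
Qed.

Lemma push_fst_box T T' (k : K) (u : {ffun T -> L}) (v : {ffun T' -> L}) :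
  total v = k%:A -> push fst (box u v) = k *: u.
Proof. by move=> vk; rewrite box_comm push_comp -(push_snd_box _ vk). Qed.

Lemma push_cst T T' (x : T') (u : {ffun T -> L}) : push (fun=> x) u = gterm (total u) x.
Proof.
apply/ffunP=> y; rewrite pushE ffunE eq_sym.
by case: eqP => _ //; rewrite big_pred0_eq.
Qed.

End Push.

(** * Embeddings that remain injective over L *)

Section LInjective.
Variables (K : fieldType) (L : fieldExtType K).
Implicit Types (T : finType) (V W : vectType K).

(* For linear rho this says that L (x)_K V -> L[T] is injective: every linear *)
(* form on V extends to an L-linear form on L[T].                             *)
Definition Linjective T V (rho : V -> {ffun T -> L}) : Prop :=
  linear rho /\ forall phi : V -> K, scalar phi ->
    exists u : T -> L, forall v, (phi v)%:A = \sum_x u x * rho v x.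

Definition rtens T1 T2 V W (r1 : V -> {ffun T1 -> L}) (r2 : W -> {ffun T2 -> L})
    : tens V W -> {ffun T1 * T2 -> L} :=
  tlift (fun v w => box (r1 v) (r2 w)).

Lemma coord_scalar V i : scalar (fun v : V => v2r v 0 i).
Proof. by move=> k u v; rewrite linearP !mxE. Qed.

Lemma Linj_inj T V (rho : V -> {ffun T -> L}) : Linjective rho -> injective rho.
Proof.
case=> _ rhoF v w vw; apply: (can_inj v2rK); apply/rowP=> i.
have [u Du] := rhoF _ (@coord_scalar V i).
by apply: (fmorph_inj (in_alg L)); rewrite /= !Du vw.
Qed.

Lemma rtens_linear T1 T2 V W (r1 : V -> {ffun T1 -> L}) (r2 : W -> {ffun T2 -> L}) :
  linear (rtens r1 r2).
Proof. exact: tlift_is_linear. Qed.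

Lemma rtens_pure T1 T2 V W (r1 : V -> {ffun T1 -> L}) (r2 : W -> {ffun T2 -> L}) v w :
  linear r1 -> linear r2 -> rtens r1 r2 (tpure v w) = box (r1 v) (r2 w).
Proof.
move=> l1 l2; rewrite /rtens tliftE //; split=> u k a b.
  by rewrite l2; apply: box_linearr.
by rewrite l1; apply: box_linearl.
Qed.

(** Reduces a statement about an arbitrary tensor to pure tensors: a bilinear expression that is
    realized by [Phi] on boxes is realized by [Phi] everywhere. *)
Lemma rtens_tlift T1 T2 T V W (U : vectType K) (r1 : V -> {ffun T1 -> L})
    (r2 : W -> {ffun T2 -> L}) (rho : U -> {ffun T -> L}) (Phi : {ffun T1 * T2 -> L} -> {ffun T -> L})
    (f : V -> W -> U) t :
    linear rho -> linear Phi ->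
    (forall v w, rho (f v w) = Phi (box (r1 v) (r2 w))) ->
  rho (tlift f t) = Phi (rtens r1 r2 t).
Proof. by move=> rl Pl fE; rewrite !linear_tlift //; apply: eq_tlift. Qed.

Lemma tens_coord V W (t : tens V W) i j :
  tlift (fun v w => (v2r v 0 i)%:A * (v2r w 0 j)%:A : L) t = (t i j)%:A.
Proof.
rewrite /tlift (bigD1 i) //= [X in _ + X]big1 ?addr0 => [|a /negPf nai].
  rewrite (bigD1 j) //= big1 ?addr0 => [|b /negPf nbj].
    by rewrite !r2vK !mxE !eqxx !scale1r mulr1.
  by rewrite !r2vK !mxE eq_sym nbj andbF scale0r mulr0 scaler0.
by apply: big1 => b _; rewrite !r2vK !mxE (eq_sym i) nai andbF scale0r mul0r scaler0.
Qed.

(** The coordinate forms on V and W extend to L-linear forms; products of these extend the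
    coordinate forms of the tensor product, and these span all forms. *)
Lemma Linj_tens T1 T2 V W (r1 : V -> {ffun T1 -> L}) (r2 : W -> {ffun T2 -> L}) :
  Linjective r1 -> Linjective r2 -> Linjective (rtens r1 r2).
Proof.
case=> l1 F1 [l2 F2]; split=> [|phi phil]; first exact: rtens_linear.
have [u1 D1] := fin_all_exists (fun i => F1 _ (@coord_scalar V i)).
have [u2 D2] := fin_all_exists (fun j => F2 _ (@coord_scalar W j)).
have coordE (t : tens V W) i j :
    (t i j)%:A = \sum_p (u1 i p.1 * u2 j p.2) * rtens r1 r2 t p.
  rewrite -tens_coord.
  have gl : linear (fun s : {ffun T1 * T2 -> L} => \sum_p (u1 i p.1 * u2 j p.2) * s p).
    move=> k s s'; rewrite scaler_sumr -big_split; apply: eq_bigr => p _.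
    by rewrite !ffunE mulrDr scalerAr.
  rewrite [RHS](linear_tlift _ _ gl); apply: eq_tlift => v w.
  rewrite D1 D2 big_distrlr pair_bigA; apply: eq_bigr => p _ /=.
  by rewrite ffunE mulrACA.
exists (fun p => \sum_i \sum_j (phi (delta_mx i j))%:A * (u1 i p.1 * u2 j p.2)) => t.
have phiE : phi t = \sum_i \sum_j t i j * phi (delta_mx i j).
  have pl : linear (phi : tens V W -> K^o) by [].
  pose phiL : {linear tens V W -> K^o} :=
    HB.pack phi (GRing.isLinear.Build _ _ _ _ (phi : tens V W -> K^o) pl).
  rewrite {1}(matrix_sum_delta t) -[phi]/(phiL : _ -> _) linear_sum.
  apply: eq_bigr => i _; rewrite linear_sum; apply: eq_bigr => j _.
  by rewrite linearZ.
under eq_bigr do rewrite mulr_suml; rewrite exchange_big /= phiE scaler_suml.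
apply: eq_bigr => i _; under eq_bigr do rewrite mulr_suml; rewrite exchange_big /=.
rewrite scaler_suml; apply: eq_bigr => j _.
rewrite mulrC -scalerA coordE -[LHS]mulr_algl mulr_sumr.
by apply: eq_bigr => p _; rewrite mulrA.
Qed.

(** The extended coordinate forms give a right inverse over L to the matrix of [rho] on a basis. *)
Lemma Linj_dim T V (rho : V -> {ffun T -> L}) : Linjective rho -> (dim V <= #|T|)%N.
Proof.
case=> rl rF; have [u Du] := fin_all_exists (fun i => rF _ (@coord_scalar V i)).
pose M := \matrix_(i < dim V, x < #|T|) rho (r2v (delta_mx 0 i)) (enum_val x).
pose U := \matrix_(x < #|T|, i < dim V) u i (enum_val x).
apply: (@mulmx1_min _ _ _ M U); apply/matrixP=> i j; rewrite !mxE.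
transitivity ((v2r (r2v (delta_mx 0 i) : V) 0 j)%:A : L).
  rewrite Du (reindex (@enum_val T T)) /=; last first.
    by exists enum_rank => x _; [exact: enum_valK | exact: enum_rankK].
  by apply: eq_bigr => x _; rewrite !mxE mulrC.
by rewrite r2vK mxE eqxx /= eq_sym; case: eqP; rewrite ?scale1r ?scale0r.
Qed.

End LInjective.

(** * Hopf algebras realized by operations on a finite set *)

Section Realization.
Variables (K : fieldType) (L : fieldExtType K).

(* rho identifies the Hopf algebra H with a form of a Hopf subalgebra of L[T], *)
(* where T has unit e, product m and inverse i.                               *)
Record realization (H : hopf_data K) (T : finType) (e : T) (m : T -> T -> T) (i : T -> T)
    (rho : H -> {ffun T -> L}) : Prop := Realization {
  real_Linj : Linjective rho;
  real_one : rho (hone H) = gterm 1 e;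
  real_mul : forall g h : H,
    rho (hmul g h) = push (fun p => m p.1 p.2) (box (rho g) (rho h));
  real_comul : forall h : H,
    rtens rho rho (hcomul h) = push (fun x => (x, x)) (rho h);
  real_counit : forall h : H, (hcounit h)%:A = total (rho h);
  real_antip : forall h : H, rho (hantip h) = push i (rho h) }.

End Realization.

Section RealizedHopf.
Variables (K : fieldType) (L : fieldExtType K) (H : hopf_data K) (T : finType).
Variables (e : T) (m : T -> T -> T) (i : T -> T) (rho : H -> {ffun T -> L}).
Hypothesis R : realization e m i rho.

Let rI := Linj_inj (real_Linj R).
Let rl : linear rho := proj1 (real_Linj R).
Let r2F := Linj_tens (real_Linj R) (real_Linj R).
Let r2l := rtens_linear rho rho.

(** A Sweedler sum over the coproduct of h turns into [Phi] evaluated on the diagonal image of h, so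
    coproducts disappear from the identities. *)
Lemma real_tlift (V : vectType K) (T' : finType) (r : V -> {ffun T' -> L})
    (Phi : {ffun T * T -> L} -> {ffun T' -> L}) (f : H -> H -> V) h :
    linear r -> linear Phi ->
    (forall h1 h2, r (f h1 h2) = Phi (box (rho h1) (rho h2))) ->
  r (tlift f (hcomul h)) = Phi (push (fun x => (x, x)) (rho h)).
Proof. by move=> rl' Pl fE; rewrite (rtens_tlift _ rl' Pl fE) (real_comul R). Qed.

(** Common end of both antipode axioms, where x |-> x^-1 x and x |-> x x^-1 are constant. *)
Lemma push_unit (g : T -> T) h : g =1 (fun=> e) ->
  push g (rho h) = rho (hcounit h *: hone H).
Proof.
move=> ge; rewrite (eq_push _ ge) push_cst linear_scaleE // (real_one R) -(real_counit R).
by apply/ffunP=> x; rewrite !ffunE; case: eqP; rewrite ?scaler0.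
Qed.

Hypotheses (mA : associative m) (m1x : left_id e m) (mx1 : right_id e m).
Hypotheses (mVx : left_inverse e i m) (mxV : right_inverse e i m).

Lemma realized_hopf_algebra : is_hopf_algebra H.
Proof.
split.
- split=> g k a b; apply: rI; rewrite rl !(real_mul R) rl.
    by rewrite box_linearr push_linear.
  by rewrite box_linearl push_linear.
- move=> x y z; apply: rI; rewrite !(real_mul R) push_boxr box_assoc push_boxl.
  by rewrite !push_comp; apply: eq_push => -[[a b] c]; apply: mA.
- move=> x; apply: rI; rewrite (real_mul R) (real_one R) box_gterm1l push_comp.
  by rewrite -[RHS]push_id; apply: eq_push.
- move=> x; apply: rI; rewrite (real_mul R) (real_one R) box_gterm1r push_comp.
  by rewrite -[RHS]push_id; apply: eq_push.
- move=> k x y; apply: (Linj_inj r2F).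
  by rewrite r2l !(real_comul R) rl push_linear.
- move=> k x y; apply: (fmorph_inj (in_alg L)); rewrite /= scalerDl -scalerA !(real_counit R) rl.
  rewrite /total scaler_sumr -big_split; apply: eq_bigr => z _.
  by rewrite !ffunE.
- move=> h; apply: (Linj_inj (Linj_tens r2F (real_Linj R))).
  rewrite (@real_tlift _ _ _ (push (fun p => ((p.1, p.1), p.2)))); first last.
  + by move=> h1 h2; rewrite rtens_pure // (real_comul R) push_boxl.
  + exact: push_linear.
  + exact: rtens_linear.
  (* Both iterated coproducts are realized by x |-> ((x, x), x). *)
  rewrite (@real_tlift _ _ _ (push (fun p => ((p.1, p.2), p.2)))); first last.
  + move=> h1 h2.
    rewrite (@real_tlift _ _ _ (fun s => push (fun p => ((p.1, p.2.1), p.2.2)) (box (rho h1) s))).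
    * by rewrite push_boxr push_comp.
    * exact: rtens_linear.
    * by move=> k u v; rewrite box_linearr push_linear.
    by move=> h21 h22; rewrite !rtens_pure // box_assocV.
  + exact: push_linear.
  + exact: rtens_linear.
  by rewrite !push_comp.
- move=> h; apply: rI; rewrite (@real_tlift _ _ _ (push snd)) ?push_comp ?push_id //.
    exact: push_linear.
  by move=> h1 h2; rewrite linear_scaleE // (push_snd_box _ (esym (real_counit R h1))).
- move=> h; apply: rI; rewrite (@real_tlift _ _ _ (push fst)) ?push_comp ?push_id //.
    exact: push_linear.
  by move=> h1 h2; rewrite linear_scaleE // (push_fst_box _ (esym (real_counit R h2))).
- apply: (Linj_inj r2F); rewrite (real_comul R) rtens_pure // (real_one R).
  by rewrite box_gterm mulr1 push_gterm.
- move=> g h; apply: (Linj_inj r2F).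
  rewrite (real_comul R) (real_mul R).
  pose sw := fun p : T * T * (T * T) => (m p.1.1 p.2.1, m p.1.2 p.2.2).
  rewrite (@real_tlift _ _ _ (fun s => push sw (box s (push (fun x => (x, x)) (rho h))))).
  + by rewrite push_box !push_comp.
  + exact: rtens_linear.
  + by move=> k u v; rewrite box_linearl push_linear.
  move=> g1 g2; rewrite (@real_tlift _ _ _ (fun s => push sw (box (box (rho g1) (rho g2)) s))) //.
  + by move=> k u v; rewrite box_linearr push_linear.
  move=> h1 h2; rewrite rtens_pure // !(real_mul R) push_box box_swap !push_comp.
  by apply: eq_push.
- apply: (fmorph_inj (in_alg L)); rewrite /= (real_counit R) (real_one R) scale1r.
  exact: total_gterm.
- move=> g h; apply: (fmorph_inj (in_alg L)); rewrite rmorphM /= !(real_counit R).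
  by rewrite (real_mul R) push_total total_box.
- by move=> k g h; apply: rI; rewrite rl !(real_antip R) rl push_linear.
- move=> h; apply: rI; rewrite (@real_tlift _ _ _ (push (fun p => m (i p.1) p.2))) //.
  + by rewrite push_comp; apply: push_unit => x /=.
  + exact: push_linear.
  by move=> h1 h2; rewrite (real_mul R) (real_antip R) push_boxl push_comp.
- move=> h; apply: rI; rewrite (@real_tlift _ _ _ (push (fun p => m p.1 (i p.2)))) //.
  + by rewrite push_comp; apply: push_unit => x /=.
  + exact: push_linear.
  by move=> h1 h2; rewrite (real_mul R) (real_antip R) push_boxr push_comp.
Qed.
End RealizedHopf.

(** * Isomorphisms induced by homomorphisms *)

Section RealizedIso.
Variables (K : fieldType) (L : fieldExtType K) (H H' : hopf_data K) (T T' : finType).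
Variables (e : T) (m : T -> T -> T) (i : T -> T) (rho : H -> {ffun T -> L}).
Variables (e' : T') (m' : T' -> T' -> T') (i' : T' -> T') (rho' : H' -> {ffun T' -> L}).
Hypotheses (R : realization e m i rho) (R' : realization e' m' i' rho').

Lemma realized_hopf_iso (g : T -> T') (f : H -> H') :
    g e = e' -> {morph g : x y / m x y >-> m' x y} -> {morph g : x / i x >-> i' x} ->
    linear f -> bijective f -> (forall h, rho' (f h) = push g (rho h)) ->
  hopf_iso f.
Proof.
move=> ge gm gi fl fb fE; have rI := Linj_inj (real_Linj R').
have rl := proj1 (real_Linj R').
split=> //.
- by apply: rI; rewrite fE (real_one R) (real_one R') push_gterm ge.
- move=> x y; apply: rI; rewrite fE (real_mul R) (real_mul R') !fE push_box !push_comp.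
  by apply: eq_push => -[a b] /=.
- move=> h; apply: (Linj_inj (Linj_tens (real_Linj R') (real_Linj R'))).
  rewrite (real_comul R') fE.
  rewrite (real_tlift R (Phi := push (fun p => (g p.1, g p.2)))).
  + by rewrite !push_comp.
  + exact: rtens_linear.
  + exact: push_linear.
  by move=> h1 h2; rewrite rtens_pure // !fE push_box.
- move=> h; apply: (fmorph_inj (in_alg L)).
  by rewrite /= (real_counit R) (real_counit R') fE push_total.
by move=> h; apply: rI; rewrite fE (real_antip R) (real_antip R') fE !push_comp; apply: eq_push.
Qed.

End RealizedIso.

(** * Smash products and semidirect products *)

Section RealizedSmash.
Variables (K : fieldType) (L : fieldExtType K) (M H : hopf_data K) (S T : finType).
Variables (e1 : S) (m1 : S -> S -> S) (i1 : S -> S) (r1 : M -> {ffun S -> L}).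
Variables (e2 : T) (m2 : T -> T -> T) (i2 : T -> T) (r2 : H -> {ffun T -> L}).
Hypotheses (R1 : realization e1 m1 i1 r1) (R2 : realization e2 m2 i2 r2).
Variables (act : H -> M -> M) (c : T -> S -> S).
Hypothesis actE : forall z w, r1 (act z w) = push (fun p => c p.1 p.2) (box (r2 z) (r1 w)).

Let l1 := proj1 (real_Linj R1).
Let l2 := proj1 (real_Linj R2).
Let I1 := Linj_inj (real_Linj R1).
Let F12 := Linj_tens (real_Linj R1) (real_Linj R2).

Lemma realized_module_action :
    c e2 =1 id -> (forall x y, c (m2 x y) =1 c x \o c y) ->
    (forall x, c x e1 = e1) -> (forall x, {morph c x : a b / m1 a b}) ->
    (forall x, {morph c x : a / i1 a}) ->
  hopf_module_action act.
Proof.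
move=> c1 cM ce cm ci; split.
- split=> z k u v; apply: I1; rewrite l1 !actE.
    by rewrite l1 box_linearr push_linear.
  by rewrite l2 box_linearl push_linear.
- move=> w; apply: I1; rewrite actE (real_one R2) box_gterm1l push_comp.
  by rewrite -[RHS]push_id; apply: eq_push.
- move=> z z' w; apply: I1; rewrite !actE (real_mul R2) push_boxl push_boxr box_assoc.
  by rewrite !push_comp; apply: eq_push => -[[a b] x]; apply: cM.
- move=> z; apply: I1; rewrite actE linear_scaleE // (real_one R1) box_gterm1r push_comp.
  rewrite (@eq_push _ _ _ _ _ (fun=> e1)) // push_cst -(real_counit R2).
  by apply/ffunP=> x; rewrite !ffunE; case: eqP; rewrite ?scaler0.
- move=> z w w'; apply: I1; rewrite actE (real_mul R1).
  rewrite (real_tlift R2 (Phi := fun s =>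
    push (fun p => m1 (c p.1.1 p.2.1) (c p.1.2 p.2.2)) (box s (box (r1 w) (r1 w'))))) //.
  + rewrite push_boxl push_boxr !push_comp; apply: eq_push => -[x [a b]] /=.
    exact: cm.
  + by move=> k u v; rewrite box_linearl push_linear.
  move=> z1 z2; rewrite (real_mul R1) !actE push_box box_swap !push_comp.
  by apply: eq_push.
- move=> z w; apply: (Linj_inj (Linj_tens (real_Linj R1) (real_Linj R1))).
  rewrite (real_comul R1) actE.
  pose sw := fun p : T * T * (S * S) => (c p.1.1 p.2.1, c p.1.2 p.2.2).
  rewrite (real_tlift R2
    (Phi := fun s => push sw (box s (push (fun x => (x, x)) (r1 w))))).
  + by rewrite push_box !push_comp.
  + exact: rtens_linear.
  + by move=> k u v; rewrite box_linearl push_linear.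
  move=> g1 g2.
  rewrite (real_tlift R1 (Phi := fun s => push sw (box (box (r2 g1) (r2 g2)) s))) //.
  + exact: rtens_linear.
  + by move=> k u v; rewrite box_linearr push_linear.
  move=> h1 h2; rewrite rtens_pure // !actE push_box box_swap !push_comp.
  by apply: eq_push.
- move=> z w; apply: (fmorph_inj (in_alg L)); rewrite rmorphM /=.
  by rewrite (real_counit R1) actE push_total total_box -(real_counit R1) -(real_counit R2).
move=> z w; apply: I1; rewrite (real_antip R1) !actE (real_antip R1) push_boxr !push_comp.
by apply: eq_push => -[x a]; exact/esym/ci.
Qed.

(** Product and inverse of the semidirect product of S by T for the action [c]. *)
Let m p q := (m1 p.1 (c p.2 q.1), m2 p.2 q.2).
Let i p := (c (i2 p.2) (i1 p.1), i2 p.2).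

(** Linearizes (a, b)^-1 = (b^-1 . a^-1, b^-1). The order of z1 and z2 is immaterial, since a
    realized coproduct is cocommutative. *)
Definition smash_antip (s : tens M H) : tens M H :=
  tlift (fun w z =>
    tlift (fun z1 z2 => tpure (act (hantip z1) (hantip w)) (hantip z2)) (hcomul z)) s.

Lemma realized_smash :
  realization (e1, e2) m i
    (rtens r1 r2 : smash_product act smash_antip -> {ffun S * T -> L}).
Proof.
have lt := rtens_linear r1 r2; split=> //=.
- by rewrite rtens_pure // (real_one R1) (real_one R2) box_gterm mulr1.
- move=> s t; pose m' p := m p.1 p.2.
  rewrite (rtens_tlift (r1 := r1) (r2 := r2)
    (Phi := fun u => push m' (box u (rtens r1 r2 t))) _ lt) //.
    by move=> k u v; rewrite box_linearl push_linear.
  move=> w z.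
  rewrite (rtens_tlift (r1 := r1) (r2 := r2)
    (Phi := fun u => push m' (box (box (r1 w) (r2 z)) u)) _ lt) //.
    by move=> k u v; rewrite box_linearr push_linear.
  move=> w' z'.
  pose g (p : S * (T * T) * (S * T)) :=
    (m1 p.1.1 (c p.1.2.1 p.2.1), m2 p.1.2.2 p.2.2).
  rewrite (real_tlift R2 (Phi := fun s => push g (box (box (r1 w) s) (box (r1 w') (r2 z'))))) //.
  + by rewrite push_boxr push_boxl push_comp.
  + by move=> k u v; rewrite box_linearr box_linearl push_linear.
  move=> z1 z2; rewrite rtens_pure // (real_mul R1) (real_mul R2) actE.
  (* Both sides become pushforwards of one box, with factors in the order w, z1, z2, w', z'. *)
  rewrite push_box push_boxr push_boxl [box (r1 w) (box _ _)]box_assoc push_boxl.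
  rewrite box_swap [box (box (r1 w) _) _]box_assocV push_boxl.
  by rewrite !push_comp; apply: eq_push.
- have ltt := rtens_linear (rtens r1 r2) (rtens r1 r2).
  move=> s; apply: (rtens_tlift s ltt (push_linear _)) => w z.
  pose sw (p : S * S * (T * T)) := ((p.1.1, p.2.1), (p.1.2, p.2.2)).
  rewrite (real_tlift R1 (Phi := fun s => push sw (box s (push (fun x => (x, x)) (r2 z))))) //.
  + by rewrite push_box !push_comp; apply: eq_push => -[].
  + by move=> k u v; rewrite box_linearl push_linear.
  move=> w1 w2.
  rewrite (real_tlift R2 (Phi := fun s => push sw (box (box (r1 w1) (r1 w2)) s))) //.
    by move=> k u v; rewrite box_linearr push_linear.
  by move=> z1 z2; rewrite !rtens_pure // box_swap.
- move=> s; rewrite /smash_counit.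
  have al : linear (fun k : K^o => (k : K)%:A : L).
    by move=> k u v; rewrite scalerDl scalerA.
  have tl : linear (@total K L (S * T)%type).
    move=> k u v; rewrite /total scaler_sumr -big_split; apply: eq_bigr => p _.
    by rewrite !ffunE.
  rewrite (linear_tlift _ _ al) (linear_tlift _ _ tl); apply: eq_tlift => w z.
  by rewrite total_box -(real_counit R1) -(real_counit R2) -[RHS](rmorphM (in_alg L)).
move=> s; apply: (rtens_tlift s lt (push_linear _)) => w z.
pose g (p : S * (T * T)) := (c (i2 p.2.1) (i1 p.1), i2 p.2.2).
rewrite (real_tlift R2 (Phi := fun s => push g (box (r1 w) s))) //.
- by rewrite push_boxr push_comp; apply: eq_push.
- by move=> k u v; rewrite box_linearr push_linear.
move=> z1 z2; rewrite rtens_pure // actE (real_antip R1) !(real_antip R2).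
rewrite !push_box push_boxl [box (r2 z1) _]box_comm push_boxl box_assocV.
by rewrite !push_comp; apply: eq_push.
Qed.

End RealizedSmash.

(** * Galois descent: realization and dimension of the fixed rings *)

Section FixedHopf.
Variables (K : fieldType) (L : splittingFieldType K) (gT : finGroupType).
Variables (sb : skew_brace gT) (sigma : gT -> gal_of {:L}).
Hypothesis galLK : galois 1 {:L}.
Hypothesis sigmaP : galois_identification sb sigma.
Local Notation LG := {ffun gT -> L}.
Local Notation HX X := (fixed_hopf sb sigma X).

Definition fixed_val (X : {group gT}) (h : HX X) : LG := vsval h.

Lemma fixed_val_linear X : linear (@fixed_val X).
Proof. by move=> k u v; rewrite /fixed_val linearP. Qed.

Lemma fixed_val_out (X : {group gT}) (h : HX X) x : x \notin X -> fixed_val h x = 0.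
Proof. by have /fixed_spaceP[h0 _] := valP h; apply: h0. Qed.

(** By [fixed_indep] a K-basis of the fixed ring stays independent over L, so the matrix [M] of its
    values has a right inverse [B]. Applying [B] to the values of [phi] on the basis yields the
    coefficients of the extended form. *)
Lemma fixed_val_Linj (X : {group gT}) : Linjective (@fixed_val X).
Proof.
split=> [|phi phil]; first exact: fixed_val_linear.
pose b (i : 'I_(dim (HX X))) : HX X := r2v (delta_mx 0 i).
have indb (k : 'I_(dim (HX X)) -> K) : \sum_i k i *: b i = 0 -> forall i, k i = 0.
  move=> kb0 i; have /rowP/(_ i) : \row_i k i = 0 :> 'rV_(dim (HX X)).
    apply: (can_inj r2vK); rewrite linear0 -kb0 (row_sum_delta (\row_i0 k i0)).
    by rewrite linear_sum; apply: eq_bigr => j _; rewrite linearZ mxE.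
  by rewrite !mxE.
pose M := \matrix_(i < dim (HX X), x < #|gT|) fixed_val (b i) (enum_val x).
have /row_freeP[B MB] : row_free M.
  apply: inj_row_free => v vM; apply/rowP=> i; rewrite mxE.
  apply: (fixed_indep galLK sigmaP indb) => x.
  have /rowP/(_ (enum_rank x)) := vM; rewrite !mxE => vMx; apply: etrans vMx.
  by apply: eq_bigr => j _; rewrite !mxE enum_rankK.
pose C := \col_i (phi (b i))%:A : 'cV[L]_(dim (HX X)).
have uE i : \sum_x (B *m C) (enum_rank x) 0 * fixed_val (b i) x = (phi (b i))%:A.
  transitivity ((M *m (B *m C)) i 0); last by rewrite mulmxA MB mul1mx mxE.
  rewrite mxE (reindex (@enum_val gT gT)) /=; last first.
    by exists enum_rank => x _; [exact: enum_valK | exact: enum_rankK].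
  by apply: eq_bigr => x _; rewrite enum_valK [M _ _]mxE mulrC.
exists (fun x => (B *m C) (enum_rank x) 0) => v.
have pl : linear (phi : HX X -> K^o) by [].
rewrite [v in LHS]coord_sum [v in RHS]coord_sum (linear_sumE _ _ pl).
rewrite (linear_sumE _ _ (@fixed_val_linear X)) scaler_suml.
under [RHS]eq_bigr do rewrite sum_ffunE mulr_sumr.
rewrite exchange_big; apply: eq_bigr => i _ /=; rewrite -[LHS]scalerA -uE scaler_sumr.
by apply: eq_bigr => x _; rewrite ffunE scalerAr.
Qed.

Lemma realized_fixed (X : {group gT}) : left_ideal sb X ->
  realization 1%g mulg invg (@fixed_val X).
Proof.
move=> leftX; split=> //.
- exact: fixed_val_Linj.
(* The unit of the subalgebra is its [algid], which is the unit of L[G] because that element lies in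
   the fixed ring. *)
- apply/eqP; suff: algid (fixed_ring sb sigma X) == 1 by [].
  rewrite algid_eq1; apply/fixed_spaceP; split=> [y | x]; last exact: star1.
  by rewrite ffunE; case: eqP => // ->; rewrite group1.
- by move=> g h; rewrite push_boxE.
- move=> h; rewrite -[RHS](fixed_comulE galLK sigmaP leftX h).
  apply: eq_tlift => u v; apply/ffunP=> -[x y].
  by rewrite galg_pureE ffunE.
- by move=> h; rewrite (fixed_counitE galLK sigmaP h).
by move=> h; rewrite /fixed_val fixed_antipE.
Qed.

(** Fixed elements span L[X] over L: [span_fixed] writes each point mass as an L-combination of
    them, so the identity matrix of size |X| factors through the dimension. *)
Lemma fixed_dim (X : {group gT}) : left_ideal sb X -> (#|X| <= dim (HX X))%N.
Proof.
move=> leftX; have [n [v [u vu]]] := span_fixed sigmaP leftX.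
pose M := \matrix_(i < dim (HX X), x < #|X|) 
  fixed_val (r2v (delta_mx 0 i) : HX X) (enum_val x).
pose C := \matrix_(y < #|X|, i < dim (HX X)) \sum_j v j * (v2r (u (enum_val y) j) 0 i)%:A.
apply: (@mulmx1_min _ _ _ C M); apply/matrixP=> y x; rewrite !mxE.
rewrite -(inj_eq enum_val_inj) eq_sym -(vu (enum_val y)) ?enum_valP //.
under eq_bigr do rewrite !mxE mulr_suml.
rewrite exchange_big; apply: eq_bigr => j _ /=.
rewrite -[vsval _]/(fixed_val (u (enum_val y) j : HX X)) [u _ _ in RHS]coord_sum.
rewrite (linear_sumE _ _ (@fixed_val_linear X)) sum_ffunE mulr_sumr.
by apply: eq_bigr => i _; rewrite ffunE -mulrA mulr_algl.
Qed.

End FixedHopf.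

(** * Conjugation action and multiplication map *)

Section Semidirect.
Variables (K : fieldType) (L : splittingFieldType K) (gT : finGroupType).
Variables (sb : skew_brace gT) (sigma : gT -> gal_of {:L}).
Variables (A B : {group gT}).
Local Notation HA := (fixed_hopf sb sigma A).
Local Notation HB := (fixed_hopf sb sigma B).
Local Notation HG := (fixed_hopf sb sigma [set: gT]%G).

Lemma bullet_push (z w : galg L gT) :
    (forall y, y \notin B -> z y = 0) -> (forall y, y \notin A -> w y = 0) ->
  bullet A B z w = push (fun p => p.1 * p.2 * p.1^-1)%g (box z w).
Proof.
have gterm0 (y : gT) : gterm (0 : L) y = 0.
  by apply/ffunP=> x; rewrite !ffunE if_same.
move=> zB wA; rewrite push_boxE /bullet big_mkcond; apply: eq_bigr => b _.
have [Bb | /zB->] := boolP (b \in B); last by rewrite big1 // => a _; rewrite mul0r gterm0.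
rewrite big_mkcond; apply: eq_bigr => a _; rewrite mulrC.
by have [Aa | /wA->] := boolP (a \in A); rewrite ?mulr0 ?gterm0.
Qed.

(** Normality keeps the support in A, and invariance holds because each [gamma sb x] is an
    automorphism of (G, .) and so respects conjugation. *)
Lemma bullet_fixed (z w : galg L gT) : (A <| [set: gT])%g ->
    z \in fixed_ring sb sigma B -> w \in fixed_ring sb sigma A ->
  bullet A B z w \in fixed_ring sb sigma A.
Proof.
move=> nA Bz Aw; have /fixed_spaceP[z0 _] := Bz; have /fixed_spaceP[w0 _] := Aw.
rewrite (bullet_push z0 w0); apply: fixed_spaceI => [y nAy | x y].
  rewrite pushE big1 // => -[b a] /= /eqP Dy; rewrite ffunE /=.
  rewrite w0 ?mulr0 //; apply: contra nAy => Aa; rewrite -Dy.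
  rewrite -{1}[b]invgK -mulgA -/(conjg a b^-1) memJ_norm //.
  by rewrite (subsetP (normal_norm nA)) ?inE.
have gI : injective (fun p : gT * gT => (gamma sb x p.1, gamma sb x p.2)).
  by move=> [a b] [a' b'] /= [/gamma_inj-> /gamma_inj->].
rewrite !pushE (reindex_inj gI) rmorph_sum /=.
apply: eq_big => [[b a] | [b a] _] /=.
  by rewrite -gammaV -!gammaM (inj_eq (@gamma_inj _ sb x)).
by rewrite !ffunE /= (fixed_gammaE _ _ Bz) (fixed_gammaE _ _ Aw) [RHS]rmorphM.
Qed.

Lemma fixed_spaceS (X Y : {set gT}) (u : galg L gT) :
  X \subset Y -> u \in fixed_space sb sigma X -> u \in fixed_space sb sigma Y.
Proof.
move=> sXY /fixed_spaceP[u0 uG]; apply/fixed_spaceP; split=> // y nYy.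
by apply: u0; apply: contra nYy; apply: subsetP.
Qed.

Definition smash_to_fixed : tens HA HB -> HG :=
  tlift (fun w z => vsproj (fixed_ring sb sigma [set: gT]%G) (vsval w * vsval z) : HG).

Lemma smash_to_fixedE s :
  fixed_val (smash_to_fixed s) =
  push (fun p => p.1 * p.2)%g
    (rtens (@fixed_val _ _ _ sb sigma A) (@fixed_val _ _ _ sb sigma B) s).
Proof.
apply: (rtens_tlift s (@fixed_val_linear _ _ _ _ _ _) (push_linear _)) => w z.
rewrite push_boxE /fixed_val vsprojK //; apply: memvM.
  exact: fixed_spaceS (subsetT A) (valP w).
exact: fixed_spaceS (subsetT B) (valP z).
Qed.

Hypothesis galLK : galois 1 {:L}.
Hypothesis sigmaP : galois_identification sb sigma.

(** The realized tensor is supported on A x B, where (a, b) |-> a b is injective; its coefficient at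
    (a, b) is therefore read off from that of the image at a b. *)
Lemma smash_to_fixed_inj : (A :&: B = 1)%g -> injective smash_to_fixed.
Proof.
move=> AB1; pose rAB := rtens (@fixed_val _ _ _ sb sigma A) (@fixed_val _ _ _ sb sigma B).
have out s p : ~~ ((p.1 \in A) && (p.2 \in B)) -> rAB s p = 0.
  rewrite negb_and => nABp; rewrite /rAB /rtens sum_ffunE big1 // => i _.
  rewrite sum_ffunE big1 // => j _; rewrite ffunE.
  suff -> (w : HA) (z : HB) : box (fixed_val w) (fixed_val z) p = 0 by rewrite scaler0.
  by rewrite ffunE; case/orP: nABp => /fixed_val_out->; rewrite ?mul0r ?mulr0.
have valE s a b : a \in A -> b \in B -> fixed_val (smash_to_fixed s) (a * b)%g = rAB s (a, b).
  move=> Aa Bb; rewrite smash_to_fixedE pushE (bigD1 (a, b)) //= big1 ?addr0 //.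
  case=> a' b' /andP[/eqP/= Dab neq]; apply: out; apply: contra neq => /= /andP[Aa' Bb'].
  have Da : (a^-1 * a' = b * b'^-1)%g.
    by apply: (mulgI a); rewrite mulKVg mulgA -Dab mulgK.
  have : (a^-1 * a')%g \in A :&: B by rewrite inE groupM ?groupV //= Da groupM ?groupV.
  rewrite AB1 => /set1gP a1; have Daa : a' = a by rewrite -(mulKVg a a') a1 mulg1.
  by move: Dab; rewrite Daa => /mulgI->.
move=> s t st.
have FA := fixed_val_Linj galLK sigmaP A; have FB := fixed_val_Linj galLK sigmaP B.
apply: (Linj_inj (Linj_tens FA FB)).
apply/ffunP=> -[a b]; have [/andP[Aa Bb] | nAB] := boolP ((a \in A) && (b \in B)).
  by rewrite -[LHS]/(rAB s (a, b)) -[RHS]/(rAB t (a, b)) -!valE // st.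
by rewrite -[LHS]/(rAB s (a, b)) -[RHS]/(rAB t (a, b)) !out.
Qed.

Lemma smash_to_fixed_bij :
    left_ideal sb A -> left_ideal sb B -> (A :&: B = 1)%g -> (A * B)%g = [set: gT] ->
  bijective smash_to_fixed.
Proof.
move=> lA lB AB1 ABG; apply: linear_inj_bij.
- exact: tlift_is_linear.
- exact: smash_to_fixed_inj.
apply: leq_trans (Linj_dim (fixed_val_Linj galLK sigmaP [set: gT]%G)) _.
rewrite -cardsT -ABG (TI_cardMg AB1).
by apply: leq_mul; apply: fixed_dim.
Qed.

End Semidirect.

Theorem proposition6p1 (K : fieldType) (L : splittingFieldType K)
    (galLK : galois 1 {:L}) (gT : finGroupType) (sb : skew_brace gT)
    (sigma : gT -> gal_of {:L}) (sigmaP : galois_identification sb sigma)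
    (A B : {group gT}) (AB : internal_semidirect sb A B) :
  let HG := fixed_hopf sb sigma [set: gT]%G in
  let HA := fixed_hopf sb sigma A in
  let HB := fixed_hopf sb sigma B in
  smash_defined sb sigma A B /\
  exists S : tens HA HB -> tens HA HB,
    let HAB := smash_product (@fixed_bullet K L gT sb sigma A B) S in
    is_hopf_algebra HAB /\ exists f : HAB -> HG, hopf_iso f.
Proof.
case: AB => -[lA nA _] lB AB1 ABG _ HG HA HB.
have lG : left_ideal sb [set: gT]%G.
  move=> x; apply/eqP; rewrite eqEcard subsetT card_imset ?leqnn //.
  exact: gamma_inj.
have RA := realized_fixed galLK sigmaP lA.
have RB := realized_fixed galLK sigmaP lB.
have RG := realized_fixed galLK sigmaP lG.
pose c (b a : gT) := (b * a * b^-1)%g.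
have actE z w : fixed_val (@fixed_bullet K L gT sb sigma A B z w) =
    push (fun p => c p.1 p.2) (box (fixed_val z) (fixed_val w)).
  rewrite /fixed_val vsprojK ?bullet_fixed ?subvsP // bullet_push // => y.
    exact: fixed_val_out.
  exact: fixed_val_out.
have cM x y z : c (x * y)%g z = c x (c y z) by rewrite /c invMg !mulgA.
have cm x : {morph c x : a b / (a * b)%g}.
  by move=> a b; rewrite /c !mulgA mulgKV.
have c1 x : c 1%g x = x by rewrite /c mul1g invg1 mulg1.
have ce x : c x 1%g = 1%g by rewrite /c mulg1 mulgV.
have cV x : {morph c x : a / (a^-1)%g} by move=> a; rewrite /c !invMg invgK mulgA.
split.
  split; first by move=> z w; apply: bullet_fixed.
  exact: (realized_module_action RA RB actE).
have RAB := realized_smash RA RB actE.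
exists (smash_antip (@fixed_bullet K L gT sb sigma A B)); split.
  apply: (realized_hopf_algebra RAB).
  - by move=> [a b] [a' b'] [a'' b''] /=; rewrite cM cm !mulgA.
  - by case=> a b /=; rewrite c1 !mul1g.
  - by case=> a b /=; rewrite ce !mulg1.
  - by case=> a b /=; rewrite -cm !mulVg ce.
  by case=> a b /=; rewrite -cM mulgV c1 mulgV.
exists (@smash_to_fixed _ _ _ sb sigma A B).
(* The realization lives on all pairs in G x G, where this homomorphism need not be injective;
   bijectivity on the fixed rings comes from [smash_to_fixed_bij]. *)
apply: (realized_hopf_iso RAB RG (g := fun p => (p.1 * p.2)%g)) => /=.
- exact: mulg1.
- by case=> a b [a' b'] /=; rewrite /c !mulgA mulgKV.
- by case=> a b /=; rewrite /c invgK mulgK invMg.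
- exact: tlift_is_linear.
- exact: smash_to_fixed_bij.
exact: smash_to_fixedE.
Qed.
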